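(* Let $q,r\in(0,1)$. If $\mathbb{J}_q\cap\mathbb{J}_r=\{0\}$, then $\|B_q-B_r\|=2$.
   Context: For $q\in(0,1)$ and $a\in\mathbb{C}$, write $(a;q)_0:=1$, $(a;q)_k:=\prod_{s=0}^{k-1}(1-aq^s)$ for $k\geqslant 1$, and $(a;q)_\infty:=\prod_{s=0}^{\infty}(1-aq^s)$. For $q\in(0,1)$, $k\in\mathbb{N}_0=\{0,1,2,\dots\}$, $x\in[0,1]$ put $$p_k(q;x):=\frac{x^k\,(x;q)_\infty}{(q;q)_k}$$ (with $x^0=1$). For $q\in(0,1)$ the limit $q$-Bernstein operator $B_q:C[0,1]\to C[0,1]$, $f\mapsto B_qf$, is the bounded linear operator given by $$B_q(f;x)=\sum_{k=0}^{\infty}f(1-q^k)\,p_k(q;x)\ \text{ for } x\in[0,1),\qquad B_q(f;1)=f(1).$$ Here $C[0,1]$ is the space of continuous functions on $[0,1]$ with the supremum norm, and $\|\cdot\|$ applied to operators is the operator norm on $C[0,1]$. For $q\in(0,1)$, $\mathbb{J}_q:=\{1-q^k:k\in\mathbb{N}_0\}$. *)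

(* Defs.v *)
From HB Require Import structures.
From mathcomp Require Import all_boot all_order all_algebra.
From mathcomp Require Import all_classical all_reals all_analysis.

Set Implicit Arguments.
Unset Strict Implicit.
Unset Printing Implicit Defensive.

Import Order.TTheory GRing.Theory Num.Theory.
Import numFieldNormedType.Exports.

Local Open Scope classical_set_scope.
Local Open Scope ring_scope.

Definition qpoch {R : realType} (a q : R) (k : nat) : R :=
  \prod_(s < k) (1 - a * q ^+ s).

Definition qpoch_inf {R : realType} (a q : R) : R :=
  limn (fun n => qpoch a q n).

Definition limit_qB_basis {R : realType} (q : R) (k : nat) (x : R) : R :=
  x ^+ k * qpoch_inf x q / qpoch q q k.

(* Only the values at x in [0, 1] are meaningful. *)
Definition limit_qB {R : realType} (q : R) (f : R -> R) (x : R) : R :=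
  if x == 1 then f 1
  else limn (series (fun k => f (1 - q ^+ k) * limit_qB_basis q k x)).

Definition qnodes {R : realType} (q : R) : set R :=
  range (fun k : nat => 1 - q ^+ k).

(* Elements of C[0,1] are represented by functions R -> R that are continuous
   on [0, 1] for the subspace topology; the values outside [0, 1] are
   irrelevant to limit_qB, sup_norm01 and op_norm01. *)
Definition C01 {R : realType} : set (R -> R) :=
  [set f : R -> R | {within `[0, 1], continuous f}].

(* Both norms take values in \bar R, so that an unbounded function or operator
   has norm +oo instead of the default value of a real supremum. *)
Definition sup_norm01 {R : realType} (f : R -> R) : \bar R :=
  ereal_sup [set (`|f x|)%:E | x in `[0 : R, 1]].

Definition op_norm01 {R : realType} (T : (R -> R) -> R -> R) : \bar R :=
  ereal_sup [set sup_norm01 (T f)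
            | f in [set f | C01 f /\ (sup_norm01 f <= 1%:E)%E]].

(* Main.v *)
(* For x in [0, 1) the weights p_k(q; x) are nonnegative and, by Euler's identity
   sum_k x^k / (q; q)_k = 1 / (x; q)_oo, they sum to 1; so both operators are
   averages and the norm of the difference is at most 2.  Conversely, fix x close
   to 1.  The weight p_0(q; x) = (x; q)_oo <= 1 - x of the only common node 0 is
   small, and all but a small part of the rest of the mass sits on finitely many
   q-nodes, and likewise for r.  These two finite sets are disjoint, so a continuous
   f with |f| <= 1 can be 1 on the first and -1 on the second, which makes
   B_q f(x) - B_r f(x) arbitrarily close to 2. *)
Require Import Defs.
From mathcomp Require Import all_boot all_order all_algebra.
From mathcomp Require Import all_classical all_reals all_analysis.
From mathcomp Require Import ring lra.
Import Order.TTheory GRing.Theory Num.Theory.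
Import numFieldNormedType.Exports.
Local Open Scope classical_set_scope.
Local Open Scope ring_scope.

Set Implicit Arguments.
Unset Strict Implicit.
Unset Printing Implicit Defensive.

(** * The q-exponential series and Euler's identity *)

Lemma series_at0 (R : realType) (u : R ^nat) : series u 0%N = 0.
Proof. by rewrite /series /= big_geq. Qed.

Lemma qpoch_q_gt0 (R : realType) (q : R) k : 0 < q -> q < 1 -> 0 < qpoch q q k.
Proof.
move=> q0 q1; apply: prodr_gt0 => s _.
by rewrite subr_gt0 -exprS exprn_ilt1 ?ltW.
Qed.

(** Terms of Euler's q-exponential, whose sum [G x] turns out to be [1 / (x; q)_oo]. *)
Definition qexp_term {R : realType} (q x : R) : R ^nat :=
  fun k => x ^+ k / qpoch q q k.

Section Euler.
Context {R : realType} (q : R).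
Hypotheses (q0 : 0 < q) (q1 : q < 1).

Lemma qexp_term_ge0 x k : 0 <= x -> 0 <= qexp_term q x k.
Proof. by move=> x0; rewrite divr_ge0 ?exprn_ge0// ltW// qpoch_q_gt0. Qed.

Lemma series_qexp_term_nd x :
  0 <= x -> nondecreasing_seq (series (qexp_term q x)).
Proof.
by move=> x0; apply: nondecreasing_series => // k _ _; exact: qexp_term_ge0.
Qed.

(** Since [(q; q)_k] ends in the factor [1 - q ^+ k], the [k]-th term at [x] minus that at [q * x]
    is [x] times the term before. This is the functional equation [G x - G (q x) = x G x] for
    partial sums, available before convergence is known. *)
Lemma series_qexp_term_sub x n :
  series (qexp_term q x) n.+1 - series (qexp_term q (q * x)) n.+1 =
  x * series (qexp_term q x) n.
Proof.
elim: n => [|n IH].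
  by rewrite !seriesSr !series_at0 /qexp_term !expr0; ring.
rewrite seriesSr (seriesSr _ n.+1) [in RHS]seriesSr mulrDr -IH /qexp_term.
have P0 := qpoch_q_gt0 n q0 q1.
have -> : qpoch q q n.+1 = qpoch q q n * (1 - q ^+ n.+1).
  by rewrite /qpoch big_ord_recr /= exprS.
have Q0 : 1 - q ^+ n.+1 != 0.
  by rewrite subr_eq0 eq_sym lt_eqF// exprn_ilt1 ?ltW.
by rewrite exprMn !exprS in Q0 *; field; rewrite Q0 gt_eqF.
Qed.

(** Replacing the shorter partial sum by the longer one in the finite functional equation gives
    [(1 - y) S_n(y) <= S_n(q y)], which is iterated from [y = x]. It carries bounds near 0 back to
    [x]. *)
Lemma qpoch_series_qexp_term_le x m n : 0 <= x -> x < 1 ->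
  qpoch x q m * series (qexp_term q x) n <= series (qexp_term q (q ^+ m * x)) n.
Proof.
move=> x0 x1; elim: m => [|m IH].
  by rewrite /qpoch big_ord0 !mul1r.
have y0 : 0 <= q ^+ m * x by rewrite mulr_ge0// exprn_ge0// ltW.
have y1 : q ^+ m * x < 1.
  rewrite (le_lt_trans _ x1)// ler_piMl//.
  by rewrite exprn_ile1// ltW.
rewrite /qpoch big_ord_recr /= -/(qpoch x q m) exprS -(mulrA q) mulrAC (mulrC x).
apply: (le_trans (y := series (qexp_term q (q ^+ m * x)) n * (1 - q ^+ m * x))).
  by rewrite ler_wpM2r// subr_ge0 ltW.
move: {IH} (q ^+ m * x) y0 y1 => y y0 y1; rewrite -/(q * y).
case: n => [|n]; first by rewrite !series_at0 mul0r.
have := series_qexp_term_sub y n.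
have : series (qexp_term q y) n <= series (qexp_term q y) n.+1.
  by apply: series_qexp_term_nd.
move=> /(ler_wpM2l y0). lra.
Qed.

(** Each factor of [(q; q)_k] is at least [1 - q]. The geometric bound is summable only for
    [x < 1 - q]. *)
Lemma qexp_term_le x k : 0 <= x -> qexp_term q x k <= (x / (1 - q)) ^+ k.
Proof.
move=> x0; rewrite expr_div_n ler_wpM2l ?exprn_ge0// lef_pV2 ?posrE.
- rewrite -[X in _ ^+ X]card_ord -prodr_const; apply: ler_prod => s _.
  rewrite subr_ge0 ltW//= lerD2l lerN2 ler_piMr ?exprn_ile1// ltW//.
- exact: qpoch_q_gt0.
- by rewrite exprn_gt0// subr_gt0.
Qed.

Lemma series_qexp_term_le2 x n : 0 <= x -> x <= (1 - q) / 2 ->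
  series (qexp_term q x) n <= 2.
Proof.
move=> x0 xq.
have d0 : 0 < 1 - q by rewrite subr_gt0.
(* The threshold on [x] makes the ratio at most 1/2; the induction needs the exact partial sum of
   the geometric series. *)
suff : series (qexp_term q x) n <= 2 - 2 * (2^-1) ^+ n.
  by move=> /le_trans; apply; rewrite gerBl mulr_ge0// exprn_ge0// invr_ge0.
elim: n => [|n IH]; first by rewrite series_at0 expr0 mulr1 subrr.
rewrite seriesSr exprS.
have : qexp_term q x n <= (2^-1) ^+ n.
  apply: (le_trans (qexp_term_le n x0)).
  apply: lerXn2r; rewrite ?nnegrE ?invr_ge0// ?divr_ge0// ?(ltW d0)//.
  by rewrite ler_pdivrMr// mulrC.
lra.
Qed.

Lemma is_cvg_series_qexp_term x : 0 <= x -> x < 1 ->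
  cvgn (series (qexp_term q x)).
Proof.
move=> x0 x1; apply: nondecreasing_is_cvgn.
  exact: series_qexp_term_nd.
(* This [m] brings [q ^+ m * x] into the range of the geometric bound, so the partial sums at [x]
   stay below [2 / (x; q)_m]. *)
have [m _ Hm] : \forall m \near \oo, q ^+ m <= (1 - q) / 2.
  have /cvgr_le : q ^+ m @[m --> \oo] --> (0 : R).
    by apply: cvg_expr; rewrite ger0_norm ?ltW.
  by apply; rewrite divr_gt0// subr_gt0.
exists (2 / qpoch x q m) => _ [n _ <-].
rewrite ler_pdivlMr; last first.
  apply: prodr_gt0 => s _; rewrite subr_gt0.
  by rewrite (le_lt_trans _ x1)// ler_piMr// exprn_ile1// ltW.
rewrite mulrC (le_trans (qpoch_series_qexp_term_le m n x0 x1))//.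
apply: series_qexp_term_le2; first by rewrite mulr_ge0// exprn_ge0// ltW.
apply: (le_trans _ (Hm m (leqnn m))).
by rewrite ler_piMr ?exprn_ge0// ltW.
Qed.

Lemma qexp_func_eq x : 0 <= x -> x < 1 ->
  limn (series (qexp_term q (q * x))) = (1 - x) * limn (series (qexp_term q x)).
Proof.
move=> x0 x1; set G := limn (series (qexp_term q x)).
have cG : series (qexp_term q x) @ \oo --> G by exact: is_cvg_series_qexp_term.
(* The finite identity links lengths [n.+1] and [n], so the limit is taken along the shifted
   sequence. *)
apply/cvg_lim => //; rewrite -cvg_shiftS.
rewrite (_ : [sequence _]_n = fun n => series (qexp_term q x) n.+1 -
    x * series (qexp_term q x) n).
  rewrite mulrBl mul1r; apply: cvgB; first by rewrite (cvg_shiftS (series _)).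
  by apply: cvgM => //; exact: cvg_cst.
by apply/funext => n /=; rewrite -series_qexp_term_sub; ring.
Qed.

Lemma qexp_func_iter x m : 0 <= x -> x < 1 ->
  limn (series (qexp_term q (q ^+ m * x))) =
  qpoch x q m * limn (series (qexp_term q x)).
Proof.
move=> x0 x1; elim: m => [|m IH].
  by rewrite /qpoch big_ord0 !mul1r.
rewrite /qpoch big_ord_recr /= -/(qpoch x q m) exprS -mulrA qexp_func_eq ?IH.
- ring.
- by rewrite mulr_ge0// exprn_ge0// ltW.
- by rewrite (le_lt_trans _ x1)// ler_piMl// exprn_ile1// ltW.
Qed.

Lemma qexp_ge1 x : 0 <= x -> x < 1 -> 1 <= limn (series (qexp_term q x)).
Proof.
move=> x0 x1; have <- : series (qexp_term q x) 1%N = 1.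
  by rewrite seriesSr series_at0 /qexp_term expr0 /qpoch big_ord0 add0r divr1.
apply: nondecreasing_cvgn_le; first exact: series_qexp_term_nd.
exact: is_cvg_series_qexp_term.
Qed.

(** For [k >= 1], [c ^+ k <= c], so only the constant term escapes the factor [c]. With [c = q ^+ m]
    this gives continuity of [G] at 0 along [q ^+ m * x]. *)
Lemma qexp_scale_le c x : 0 <= c -> c <= 1 -> 0 <= x -> x < 1 ->
  limn (series (qexp_term q (c * x))) <=
  1 + c * limn (series (qexp_term q x)).
Proof.
move=> c0 c1 x0 x1.
have y0 : 0 <= c * x by rewrite mulr_ge0.
apply: limr_le.
  by apply: is_cvg_series_qexp_term => //; rewrite (le_lt_trans _ x1)// ler_piMl.
near=> n.
apply: (@le_trans _ _ (1 + c * series (qexp_term q x) n)); last first.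
  rewrite lerD2l ler_wpM2l//; apply: nondecreasing_cvgn_le.
    exact: series_qexp_term_nd.
  exact: is_cvg_series_qexp_term.
elim: {+}n => [|k IH]; first by rewrite !series_at0; lra.
rewrite !seriesSr; case: k IH => [|k] IH.
  rewrite !series_at0 /qexp_term !expr0 /qpoch big_ord0; lra.
suff : qexp_term q (c * x) k.+1 <= c * qexp_term q x k.+1 by lra.
rewrite /qexp_term exprMn mulrA ler_wpM2r//.
  by rewrite invr_ge0 ltW// qpoch_q_gt0.
rewrite ler_wpM2r ?exprn_ge0// exprS ler_piMr// exprn_ile1//.
Unshelve. all: end_near. Qed.

(* Iterating [G x = G (q x) / (1 - x)] gives [(x; q)_m G x = G (q^m x)], which
   tends to [G 0 = 1]. *)
Lemma euler_qexp x : 0 <= x -> x < 1 ->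
  qpoch x q @ \oo --> (limn (series (qexp_term q x)))^-1.
Proof.
move=> x0 x1; set G := limn _.
have G1 : 1 <= G by exact: qexp_ge1.
have G0 : 0 < G by lra.
rewrite (_ : qpoch x q = fun m => limn (series (qexp_term q (q ^+ m * x))) * G^-1);
  last first.
  by apply/funext => m; rewrite qexp_func_iter// mulfK// gt_eqF.
rewrite -[X in _ --> X]mul1r; apply: cvgM; last exact: cvg_cst.
apply: (@squeeze_cvgr _ _ _ _ (fun=> 1) (fun m => 1 + q ^+ m * G)).
- near=> m; apply/andP; split.
    apply: qexp_ge1; first by rewrite mulr_ge0// exprn_ge0// ltW.
    by rewrite (le_lt_trans _ x1)// ler_piMl// exprn_ile1// ltW.
  by apply: qexp_scale_le; rewrite ?exprn_ge0 ?exprn_ile1// ltW.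
- exact: cvg_cst.
- rewrite -[X in _ --> X]addr0 -(mul0r G); apply: cvgD; first exact: cvg_cst.
  apply: cvgM; last exact: cvg_cst.
  by apply: cvg_expr; rewrite ger0_norm ?ltW.
Unshelve. all: end_near. Qed.

Lemma limit_qB_basis_ge0 k x : 0 <= x -> x < 1 -> 0 <= limit_qB_basis q k x.
Proof.
move=> x0 x1; rewrite /limit_qB_basis divr_ge0 ?(ltW (qpoch_q_gt0 _ _ _))//.
rewrite mulr_ge0 ?exprn_ge0// /qpoch_inf.
rewrite (cvg_lim _ (euler_qexp x0 x1))// invr_ge0.
exact: (le_trans ler01 (qexp_ge1 x0 x1)).
Qed.

Lemma limit_qB_basis_sum x : 0 <= x -> x < 1 ->
  series (fun k => limit_qB_basis q k x) @ \oo --> (1 : R).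
Proof.
move=> x0 x1; have G1 := qexp_ge1 x0 x1.
have cG := is_cvg_series_qexp_term x0 x1.
rewrite (_ : series _ = fun n => series (qexp_term q x) n * qpoch_inf x q).
  rewrite /qpoch_inf (cvg_lim _ (euler_qexp x0 x1))//.
  rewrite -(mulfV (lt0r_neq0 (lt_le_trans ltr01 G1))).
  by apply: cvgM => //; exact: cvg_cst.
apply/funext => n; rewrite /series/= mulr_suml; apply: eq_bigr => k _.
by rewrite /limit_qB_basis mulrAC.
Qed.

(** The first factor of [(x; q)_oo] is [1 - x], and all the others lie in [[0, 1]]. *)
Lemma limit_qB_basis0_le x : 0 <= x -> x < 1 -> limit_qB_basis q 0 x <= 1 - x.
Proof.
move=> x0 x1; rewrite /limit_qB_basis expr0 mul1r /qpoch [X in _ / X]big_ord0 divr1.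
apply: limr_le; first by apply/cvg_ex; eexists; exact: euler_qexp.
near=> n; have : (0 < n)%N by near: n; exists 1%N.
case: {+}n => // m _; rewrite /qpoch big_ord_recl expr0 mulr1 ler_piMr//.
  by rewrite subr_ge0 ltW.
apply: prodr_ile1 => s _; have xq : 0 <= x * q ^+ (lift ord0 s).
  by rewrite mulr_ge0// exprn_ge0// ltW.
rewrite gerBl xq andbT subr_ge0 (le_trans _ (ltW x1))// ler_piMr//.
by rewrite exprn_ile1// ltW.
Unshelve. all: end_near. Qed.

End Euler.

(** * Averages with nonnegative weights of total mass 1 *)

Section WeightedAverage.
Context {R : realType} (p : R ^nat).
Hypotheses (p_ge0 : forall k, 0 <= p k) (p_sum : series p @ \oo --> (1 : R)).

Lemma weighted_series_cvg (a : R ^nat) :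
  (forall k, `|a k| <= 1) -> cvgn (series (fun k => a k * p k)).
Proof.
move=> a1; apply: normed_cvg; apply: (@series_le_cvg _ _ p) => //.
- by move=> n; exact: normr_ge0.
- by move=> n /=; rewrite normrM (ger0_norm (p_ge0 _)) ler_piMl.
- by apply/cvg_ex; exists 1.
Qed.

Lemma weighted_series_le1 (a : R ^nat) :
  (forall k, `|a k| <= 1) -> `|limn (series (fun k => a k * p k))| <= 1.
Proof.
move=> a1; have ca := weighted_series_cvg a1.
rewrite -lim_norm// -(cvg_lim _ p_sum)//; apply: ler_lim.
- exact: is_cvg_norm.
- by apply/cvg_ex; exists 1.
near=> n; rewrite /series/= (le_trans (ler_norm_sum _ _ _))//.
by apply: ler_sum => k _; rewrite normrM (ger0_norm (p_ge0 _)) ler_piMl.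
Unshelve. all: end_near. Qed.

(** As the weights sum to 1, the deviation is the sum of [(a k - c) * p k]. Indices 1 to [M]
    contribute nothing; since [|a k - c| <= 2], index 0 and the tail beyond [M] contribute at most
    [2 * e] each. *)
Lemma weighted_series_near (a : R ^nat) c e M :
  (forall k, `|a k| <= 1) -> `|c| <= 1 ->
  p 0 <= e -> 1 - e <= series p M.+1 ->
  (forall k, (k < M)%N -> a k.+1 = c) ->
  `|limn (series (fun k => a k * p k)) - c| <= 4 * e.
Proof.
move=> a1 c1 pe pM ac; have ca := weighted_series_cvg a1.
have cc : series (fun k => a k * p k) n - c * series p n @[n --> \oo] -->
    limn (series (fun k => a k * p k)) - c.
  rewrite -[X in _ - X]mulr1; apply: cvgB => //.
  by apply: cvgM => //; exact: cvg_cst.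
have d2 k : `|a k - c| <= 2 by rewrite (le_trans (ler_normB _ _))// lerD.
rewrite -(cvg_lim _ (cvg_norm cc))//; apply: limr_le.
  by apply/cvg_ex; eexists; exact: cvg_norm cc.
near=> n; have Mn : (M < n)%N by near: n; exists M.+1.
have pn : series p n <= 1.
  rewrite -(cvg_lim _ p_sum)//; apply: nondecreasing_cvgn_le.
    by apply: nondecreasing_series => k _ _.
  by apply/cvg_ex; exists 1.
have -> : series (fun k => a k * p k) n - c * series p n =
    \sum_(0 <= k < n) (a k - c) * p k.
  rewrite /series/= mulr_sumr -sumrB; apply: eq_bigr => k _.
  ring.
rewrite (big_cat_nat (n := M.+1))//= big_nat_recl//=.
rewrite [X in _ + X + _]big1_seq ?addr0; last first.
  by move=> k /andP[_]; rewrite mem_index_iota => /andP[_ kM]; rewrite ac// subrr mul0r.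
rewrite (le_trans (ler_normD _ _))//.
have h0 : `|(a 0 - c) * p 0| <= 2 * e.
  by rewrite normrM (ger0_norm (p_ge0 _)) ler_pM.
have h1 : `|\sum_(M.+1 <= k < n) (a k - c) * p k| <= 2 * (series p n - series p M.+1).
  rewrite sub_series_geq// mulr_sumr (le_trans (ler_norm_sum _ _ _))//.
  by apply: ler_sum => k _; rewrite normrM (ger0_norm (p_ge0 _)) ler_wpM2r.
lra.
Unshelve. all: end_near. Qed.

End WeightedAverage.

(** * Continuous separation of two disjoint finite sets *)

Lemma separating_continuous (R : realType) (A B : seq R) :
  (forall a, a \in A -> a \notin B) ->
  exists f : R -> R, [/\ continuous f, forall x, `|f x| <= 1,
    forall a, a \in A -> f a = 1 & forall b, b \in B -> f b = -1].
Proof.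
move=> AB.
(* Squaring makes [u] and [v] nonnegative with zero sets [A] and [B]. By disjointness [u + v] never
   vanishes, and [(v - u) / (u + v)] is the separating function. *)
pose u := (\prod_(a <- A) ('X - a%:P)) ^+ 2.
pose v := (\prod_(b <- B) ('X - b%:P)) ^+ 2.
have u0 x : 0 <= u.[x] by rewrite horner_exp sqr_ge0.
have v0 x : 0 <= v.[x] by rewrite horner_exp sqr_ge0.
have uE x : (u.[x] == 0) = (x \in A).
  by rewrite horner_exp sqrf_eq0 -rootE root_prod_XsubC.
have vE x : (v.[x] == 0) = (x \in B).
  by rewrite horner_exp sqrf_eq0 -rootE root_prod_XsubC.
have uv x : 0 < u.[x] + v.[x].
  rewrite lt_neqAle addr_ge0// andbT eq_sym paddr_eq0// uE vE.
  by apply/negP => /andP[/AB/negP].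
exists (fun x => (v - u).[x] / (u + v).[x]); split.
- move=> x; apply: (@continuousM _ _ (horner (v - u))).
    exact: continuous_horner.
  apply: continuousV; last exact: continuous_horner.
  by rewrite hornerD gt_eqF.
- move=> x; rewrite normrM normfV (hornerD u v) (gtr0_norm (uv x)).
  rewrite ler_pdivrMr// mul1r !hornerD hornerN ler_norml.
  have := u0 x; have := v0 x; lra.
- move=> a; rewrite -uE !hornerD hornerN => /eqP u_a0; rewrite u_a0 subr0 add0r divff//.
  by have := uv a; rewrite u_a0 add0r => /lt0r_neq0.
- move=> b; rewrite -vE !hornerD hornerN => /eqP v_b0; rewrite v_b0 sub0r addr0 mulNr divff//.
  by have := uv b; rewrite v_b0 addr0 => /lt0r_neq0.
Qed.

(** * Bounds for a single limit q-Bernstein operator *)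

Section LimitQB.
Context {R : realType} (q : R).
Hypotheses (q0 : 0 < q) (q1 : q < 1).

Lemma qnode_itv k : 1 - q ^+ k \in `[0, 1].
Proof. by rewrite in_itv/= gerBl subr_ge0 exprn_ile1 ?exprn_ge0// ltW. Qed.

Lemma limit_qB_le1 (f : R -> R) x : (forall y, y \in `[0, 1] -> `|f y| <= 1) ->
  x \in `[0, 1] -> `|limit_qB q f x| <= 1.
Proof.
move=> f1; rewrite in_itv/= => /andP[x0 x1]; rewrite /limit_qB.
case: eqVneq => [_|xn1]; first by rewrite f1// in_itv/= ler01 lexx.
have {xn1}x1 : x < 1 by rewrite lt_neqAle xn1.
apply: (weighted_series_le1 (p := fun k => limit_qB_basis q k x)).
- by move=> k; exact: limit_qB_basis_ge0.
- exact: limit_qB_basis_sum.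
- by move=> k; rewrite f1// qnode_itv.
Qed.

(** [M] is chosen before [f], so that [f] can later be built from the cutoffs of both operators.
    Nothing is asked of [f] at the node 0, whose weight is at most [1 - x]. *)
Lemma limit_qB_near x e : 0 < e -> 0 <= x -> x < 1 -> 1 - x <= e ->
  exists M, forall (f : R -> R) c,
    (forall y, `|f y| <= 1) -> `|c| <= 1 ->
    (forall k, (k < M)%N -> f (1 - q ^+ k.+1) = c) ->
    `|limit_qB q f x - c| <= 4 * e.
Proof.
move=> e0 x0 x1 xe; have ps := limit_qB_basis_sum q0 q1 x0 x1.
have [M _ HM] : \forall n \near \oo,
    1 - e <= series (fun k => limit_qB_basis q k x) n.
  by move/cvgr_ge : ps; apply; rewrite gtrBl.
exists M => f c f1 c1 fc; rewrite /limit_qB lt_eqF//.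
apply: (@weighted_series_near _ (fun k => limit_qB_basis q k x) _ _ _ _ _ M) => //.
- by move=> k; exact: limit_qB_basis_ge0.
- exact: le_trans (limit_qB_basis0_le q0 q1 x0 x1) xe.
- exact: HM _ (leqnSn M).
Qed.

End LimitQB.

(** * The norm of the difference *)

Theorem theorem1p4 (R : realType) (q r : R)
    (hq : 0 < q /\ q < 1) (hr : 0 < r /\ r < 1)
    (hJ : qnodes q `&` qnodes r = [set 0]) :
  op_norm01 (fun f : R -> R => limit_qB q f \- limit_qB r f) = 2%:E.
Proof.
case: hq hr => q0 q1 [r0 r1].
(* A coincidence would be a common node, hence 0 by [hJ], while nodes with positive exponent are
   nonzero. *)
have nodes_neq k l : 1 - q ^+ k.+1 != 1 - r ^+ l.+1.
  apply/eqP => qr; have : (qnodes q `&` qnodes r) (1 - q ^+ k.+1).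
    by split; [exists k.+1|exists l.+1].
  rewrite hJ /= => /eqP; rewrite subr_eq0 eq_sym lt_eqF//.
  by rewrite exprn_ilt1// ltW.
apply/eqP; rewrite eq_le; apply/andP; split.
  apply: ge_ereal_sup => _ [f [_ f1] <-]; apply: ge_ereal_sup => _ [x x01 <-].
  have {}f1 y : y \in `[0, 1] -> `|f y| <= 1.
    move=> y01; rewrite -lee_fin (le_trans _ f1)//.
    by apply: ereal_sup_ubound; exists y.
  rewrite lee_fin /= (le_trans (ler_normB _ _))//.
  by rewrite (_ : 2 = 1 + 1)// lerD// limit_qB_le1.
apply/lee_addgt0Pr => e e0.
(* [d] is both the distance from [x = 1 - d] to 1 and the tolerance: each operator misses its target
   by at most [4 * d], a total of at most [e]. The bound 1/2 keeps [x] in [[0, 1)]. *)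
pose d := Num.min (e / 8) (1 / 2).
have d0 : 0 < d by rewrite lt_min !divr_gt0.
have de : d <= e / 8 by rewrite ge_min lexx.
have d1 : d <= 1 / 2 by rewrite ge_min lexx orbT.
have x0 : 0 <= 1 - d by lra.
have x1 : 1 - d < 1 by lra.
have xd : 1 - (1 - d) <= d by lra.
have [M HM] := limit_qB_near q0 q1 d0 x0 x1 xd.
have [N HN] := limit_qB_near r0 r1 d0 x0 x1 xd.
(* Exponents start at 1, which leaves out the shared node 0 and makes the two lists disjoint. *)
have [a|f [cf f1 fq fr]] := @separating_continuous R
    [seq 1 - q ^+ k.+1 | k <- iota 0 M] [seq 1 - r ^+ k.+1 | k <- iota 0 N].
  move=> /mapP[k _ ->]; apply/negP => /mapP[l _ /eqP].
  by rewrite (negbTE (nodes_neq k l)).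
have {}HM : `|limit_qB q f (1 - d) - 1| <= 4 * d.
  apply: HM => // [|k kM]; first by rewrite normr1.
  by apply: fq; apply/mapP; exists k; rewrite ?mem_iota.
have {}HN : `|limit_qB r f (1 - d) - -1| <= 4 * d.
  apply: HN => // [|k kN]; first by rewrite normrN1.
  by apply: fr; apply/mapP; exists k; rewrite ?mem_iota.
have : (2 - e <= `|limit_qB q f (1 - d) - limit_qB r f (1 - d)|).
  apply: le_trans (ler_norm _).
  move: HM HN; rewrite !ler_norml => /andP[? ?] /andP[? ?]; lra.
rewrite lerBlDr -lee_fin (EFinD _ e) => /le_trans; apply; rewrite leeD2r//.
apply: ereal_sup_ge; eexists.
  exists f; last by []; split; first exact: continuous_subspaceT.
  by apply: ge_ereal_sup => _ [y _ <-]; rewrite lee_fin.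
apply: ereal_sup_ubound; exists (1 - d) => //=.
by rewrite in_itv/= x0 ltW.
Qed.
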